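(* Let $\mathbb{K}$ be a field and let $0\le \ell<k$ be fixed integers. Then for every prime number $n>k$ there exists a simplicial complex $X_{n,k,\ell}$ with $\Delta_{n-1}^{(k-1)}\subset X_{n,k,\ell}\subset\Delta_{n-1}^{(k)}$ such that $$\lambda_{\ell,k-\ell-2}(X_{n,k,\ell})=\sum_{\tau\in X_{n,k,\ell}(\ell)}\tilde{\beta}_{k-\ell-2}(\mathrm{lk}(X_{n,k,\ell},\tau))=0$$ and $$\tilde{\beta}_{k-1}(X_{n,k,\ell})\ge (1-O(n^{-1}))\,B_{n,k,\ell},\qquad B_{n,k,\ell}=\frac{\binom{n-1}{\ell}\binom{n-\ell-2}{k-\ell}}{\binom{k+1}{\ell+1}}.$$ That is, there is a constant $C$, not depending on $n$, such that $\tilde{\beta}_{k-1}(X_{n,k,\ell})\ge (1-C/n)B_{n,k,\ell}$ for all primes $n>k$.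
   Context: Simplicial complexes are finite abstract simplicial complexes containing the empty simplex (of dimension $-1$). $\Delta_{n-1}$ is the full simplex on the vertex set $[n]=\{0,\ldots,n-1\}$, and $Y^{(j)}$ denotes the $j$-dimensional skeleton of a complex $Y$. $X(j)$ is the set of $j$-dimensional simplices of $X$. For $\tau\in X$, the link is $\mathrm{lk}(X,\tau)=\{\sigma\in X: \sigma\cup\tau\in X,\ \sigma\cap\tau=\emptyset\}$. $\tilde{\beta}_j(Y)=\dim_{\mathbb{K}}\tilde{H}_j(Y;\mathbb{K})$ is the reduced Betti number over the fixed field $\mathbb{K}$; in particular $\tilde\beta_{-1}(\{\emptyset\})=1$ and $\tilde\beta_{-1}(Y)=0$ if $Y$ has a vertex. $\subset$ allows equality. *)

(* Defs.v *)
From HB Require Import structures.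
From mathcomp Require Import all_boot all_order all_algebra.
From mathcomp Require Import zify.

Set Implicit Arguments.
Unset Strict Implicit.
Unset Printing Implicit Defensive.

Import Order.TTheory GRing.Theory Num.Theory.
Local Open Scope ring_scope.

(* Dimensions are integers, because the empty simplex has dimension -1. *)
Definition dim_simplex (n : nat) (s : {set 'I_n}) : int := #|s|%:Z - 1.

(* 'I_n is the ambient vertex set: [set i] need not belong to X for all i. *)
Definition simplicial_complex (n : nat) (X : {set {set 'I_n}}) : Prop :=
  set0 \in X /\
  forall s t : {set 'I_n}, s \in X -> t \subset s -> t \in X.

Definition full_simplex (n : nat) : {set {set 'I_n}} := [set: {set 'I_n}].

Definition skeleton (n : nat) (X : {set {set 'I_n}}) (j : int) :
    {set {set 'I_n}} :=
  [set s in X | dim_simplex s <= j].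

Definition simplices (n : nat) (X : {set {set 'I_n}}) (j : int) :
    {set {set 'I_n}} :=
  [set s in X | dim_simplex s == j].

Definition link (n : nat) (X : {set {set 'I_n}}) (t : {set 'I_n}) :
    {set {set 'I_n}} :=
  [set s in X | (s :|: t \in X) && (s :&: t == set0)].

Section Homology.
Variables (K : fieldType) (n : nat).

(* The space spanned by all subsets of 'I_n; the chain groups of the complexes
   on 'I_n are subspaces of it. *)
Local Notation chain := {ffun {set 'I_n} -> K^o}.

Definition basis_chain (s : {set 'I_n}) : chain :=
  [ffun t => (t == s)%:R].

(* The sign is (-1)^p, for p the position of i in s listed increasingly. *)
Definition boundary_simplex (s : {set 'I_n}) : chain :=
  \sum_(i in s)
    (-1 : K) ^+ #|[set j in s | (j < i)%N]| *: basis_chain (s :\ i).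

Definition boundary_fun (c : chain) : chain :=
  \sum_(s : {set 'I_n}) (c s : K) *: boundary_simplex s.

Fact boundary_fun_is_linear : linear boundary_fun.
Proof.
move=> a u v; rewrite /boundary_fun scaler_sumr -big_split /=.
by apply: eq_bigr => s _; rewrite !ffunE scalerDl scalerA.
Qed.

HB.instance Definition _ :=
  GRing.isLinear.Build K chain chain _ boundary_fun boundary_fun_is_linear.

(* The empty simplex is a basis element, so this is the augmented complex,
   which computes reduced homology. *)
Definition boundary : 'End(chain) := linfun boundary_fun.

Definition chains (X : {set {set 'I_n}}) (j : int) : {vspace chain} :=
  <<[seq basis_chain s | s <- enum (simplices X j)]>>%VS.

Definition cycles (X : {set {set 'I_n}}) (j : int) : {vspace chain} :=
  (chains X j :&: lker boundary)%VS.

Definition boundaries (X : {set {set 'I_n}}) (j : int) : {vspace chain} :=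
  (boundary @: chains X (j + 1))%VS.

(* The subtraction does not truncate: see [boundaries_sub_cycles]. *)
Definition reduced_betti (X : {set {set 'I_n}}) (j : int) : nat :=
  (\dim (cycles X j) - \dim (boundaries X j))%N.

Lemma boundary_basis (s : {set 'I_n}) :
  boundary (basis_chain s) = boundary_simplex s.
Proof.
rewrite /boundary lfunE /= /boundary_fun (bigD1 s) //= big1 ?addr0.
  by rewrite ffunE eqxx scale1r.
by move=> t /negPf ts; rewrite ffunE ts scale0r.
Qed.

Lemma boundary_boundary (s : {set 'I_n}) :
  boundary (boundary (basis_chain s)) = 0.
Proof.
pose sg (t : {set 'I_n}) (i : 'I_n) : K :=
  (-1) ^+ #|[set j in t | (j < i)%N]|.
pose f (i j : 'I_n) : chain :=
  (sg s i * sg (s :\ i) j) *: basis_chain ((s :\ i) :\ j).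
have sg_lt (i j : 'I_n) : (i < j)%N -> sg (s :\ j) i = sg s i.
  move=> ij; congr (_ ^+ #|pred_of_set _|); apply/setP=> x.
  rewrite !inE; case: eqP => [->|//].
  by rewrite [(j < i)%N]ltnNge (ltnW ij) !andbF.
have sg_gt (i j : 'I_n) : i \in s -> (i < j)%N -> sg s j = - sg (s :\ i) j.
  move=> si ij; rewrite /sg (cardsD1 i) inE si ij exprS mulN1r.
  congr (- (_ ^+ #|pred_of_set _|)); apply/setP=> x.
  by rewrite !inE andbA.
have anti (i j : 'I_n) : i \in s -> (i < j)%N -> f i j = - f j i.
  move=> si ij; rewrite /f -scaleNr (sg_lt i j) // (sg_gt i j) //.
  rewrite mulNr opprK mulrC; congr (_ *: basis_chain _).
  by apply/setP=> x; rewrite !inE andbCA.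
have -> : boundary (boundary (basis_chain s)) =
    \sum_(i in s) \sum_(j in s | j != i) f i j.
  rewrite boundary_basis linear_sum; apply: eq_bigr => i si.
  rewrite linearZ /= boundary_basis scaler_sumr.
  apply: eq_big => [j|j _]; first by rewrite !inE andbC.
  by rewrite scalerA.
have -> : \sum_(i in s) \sum_(j in s | j != i) f i j =
    \sum_(i in s) \sum_(j in s | (i < j)%N) f i j
  + \sum_(i in s) \sum_(j in s | (j < i)%N) f i j.
  rewrite -big_split; apply: eq_bigr => i si /=.
  rewrite (bigID (fun j : 'I_n => (i < j)%N)) /=; congr (_ + _);
    apply: eq_bigl => j; rewrite -andbA; congr (_ && _);
    rewrite -val_eqE /=; by case: ltngtP.
rewrite [X in _ + X](exchange_big_dep (mem s)) /=; last by move=> i j _ /andP[].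
rewrite -big_split big1 // => i si /=; rewrite -[X in X + _]opprK.
apply/eqP; rewrite addrC subr_eq0 -sumrN; apply/eqP.
apply: eq_big => [j|j /andP[sj /= /andP[_ ij]]]; first by rewrite si.
by rewrite (anti i j) ?opprK.
Qed.

Lemma boundaries_sub_cycles (X : {set {set 'I_n}}) (j : int) :
  simplicial_complex X -> (boundaries X j <= cycles X j)%VS.
Proof.
case=> _ closedX; rewrite /boundaries limg_span; apply/span_subvP=> c.
case/mapP=> _ /mapP[s + ->] ->; rewrite mem_enum inE => /andP[Xs /eqP dims].
rewrite memv_cap memv_ker boundary_boundary eqxx andbT boundary_basis.
apply: memv_suml => i si; apply: memvZ; apply: memv_span; apply: map_f.
rewrite mem_enum inE (closedX s) ?subD1set //=.
by move: dims; rewrite /dim_simplex (cardsD1 i) si; lia.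
Qed.

Definition lambda (X : {set {set 'I_n}}) (l j : int) : nat :=
  \sum_(t in simplices X l) reduced_betti (link X t) j.

End Homology.

Arguments reduced_betti K {n} X j.
Arguments lambda K {n} X l j.

(* The natural subtractions do not truncate when l < k < n. *)
Definition betti_bound (R : realFieldType) (n k l : nat) : R :=
  ('C(n - 1, l) * 'C(n - l - 2, k - l))%:R / 'C(k + 1, l + 1)%:R.
Arguments betti_bound R n k l : clear implicits.

(* Main.v *)
Require Import Defs.
From HB Require Import structures.
From mathcomp Require Import all_boot all_order all_algebra.
From mathcomp Require Import zify ring lra.

(* Put d = k - l. The k-simplices of X are the (k+1)-sets whose sum modulo n
   lies in {0, ..., d-1}, together with O(n^(k-1)) repairing simplices, so there
   are at most d/(k+1) C(n,k) + O(n^(k-1)) of them, and each of them lowers the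
   Betti number of the full (k-1)-skeleton by at most one.

   Fix a simplex t of dimension l, and let B be the space of boundaries of the
   d-element simplices of its link. For a d-tuple x of residues modulo n, the
   simplices [x_1 + e_1, ..., x_d + e_d] with e in {0,1}^d are the facets of a
   cross-polytope, whose signed sum is a cycle. Their sums run over d + 1
   consecutive residues, the last one being attained by a single facet. Hence if
   the boundary of every oriented simplex with sum in d given consecutive
   residues lies in B, then so does the boundary of every oriented simplex, and
   the link has no homology in dimension d - 2. The vertices of t, which are
   missing from the link, are first retracted onto one vertex outside t; the
   repairing simplices are those which this retraction produces. *)

Set Implicit Arguments.
Unset Strict Implicit.
Unset Printing Implicit Defensive.

Import Order.TTheory GRing.Theory Num.Theory.
Local Open Scope ring_scope.

(** * Cones and oriented simplices *)

Section Chains.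
Variables (K : fieldType) (n : nat).
Local Notation chain := {ffun {set 'I_n} -> K^o}.
Local Notation ebase := (@basis_chain K n).
Local Notation bd := (@boundary K n).
Implicit Types (s t : {set 'I_n}) (v w : 'I_n) (c : chain) (x y z : seq 'I_n).

Lemma chain_sum_basis c : c = \sum_s c s *: ebase s.
Proof.
apply/ffunP=> t; rewrite sum_ffunE (bigD1 t) //= !ffunE eqxx big1 ?addr0.
  by rewrite /GRing.scale /= mulr1.
by move=> s /negPf st; rewrite !ffunE eq_sym st /GRing.scale /= mulr0.
Qed.

Definition simplex_sign v s : K := (-1) ^+ #|[set j in s | (j < v)%N]|.

Lemma simplex_signK v s : simplex_sign v s * simplex_sign v s = 1.
Proof. by rewrite /simplex_sign -expr2 sqrr_sign. Qed.

Lemma simplex_signD1 v w s :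
  simplex_sign v (s :\ w) =
  (if (w \in s) && (w < v)%N then -1 else 1) * simplex_sign v s.
Proof.
rewrite /simplex_sign; case: ifPn => ws.
  rewrite [in RHS](cardsD1 w) inE ws exprS mulrA mulN1r opprK mul1r.
  by congr (_ ^+ #|pred_of_set _|); apply/setP=> j; rewrite !inE andbA.
rewrite mul1r; congr (_ ^+ #|pred_of_set _|); apply/setP=> j; rewrite !inE.
by have [->|//] := eqVneq j w; rewrite (negPf ws).
Qed.

(** Exterior multiplication by v on the left: the sign moves v to its place in the increasing
    order. *)
Definition cone_simplex v s : chain :=
  if v \in s then 0 else simplex_sign v s *: ebase (v |: s).

Definition cone_fun v (c : chain) : chain := \sum_s (c s : K) *: cone_simplex v s.

Fact cone_fun_is_linear v : linear (cone_fun v).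
Proof.
move=> a c1 c2; rewrite /cone_fun scaler_sumr -big_split /=.
by apply: eq_bigr => s _; rewrite !ffunE scalerDl scalerA.
Qed.

HB.instance Definition _ v :=
  GRing.isLinear.Build K chain chain _ (cone_fun v) (cone_fun_is_linear v).

Definition cone v : 'End(chain) := linfun (cone_fun v).

Lemma cone_basis v s : cone v (ebase s) = cone_simplex v s.
Proof.
rewrite lfunE /= /cone_fun (bigD1 s) //= big1 ?addr0 => [|t /negPf ts].
  by rewrite ffunE eqxx scale1r.
by rewrite ffunE ts scale0r.
Qed.

(** Coning is a chain homotopy between the identity and zero. If v already lies in s, the cone of s
    vanishes, and coning its boundary keeps only the face [s :\ v], which gives back s. *)
Lemma boundary_cone v c : bd (cone v c) = c - cone v (bd c).
Proof.
suff cone_e s : bd (cone v (ebase s)) = ebase s - cone v (bd (ebase s)).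
  rewrite [c]chain_sum_basis !linear_sum -big_split /=; apply: eq_bigr => s _.
  by rewrite !linearZ /= cone_e scalerDr.
rewrite cone_basis boundary_basis /cone_simplex linear_sum /=.
under eq_bigr do rewrite linearZ /= cone_basis /cone_simplex -/(simplex_sign _ _).
case: ifPn => [vs|vNs].
  rewrite linear0 (bigD1 v) //= big1 ?addr0 => [|i /andP[si iv]].
    rewrite setD11 setD1K // simplex_signD1 ltnn andbF mul1r scalerA.
    by rewrite simplex_signK scale1r subrr.
  by rewrite in_setD1 vs eq_sym iv scaler0.
have sgU i : simplex_sign i s =
    (if (v < i)%N then -1 else 1) * simplex_sign i (v |: s).
  by rewrite -{1}(setU1K vNs) simplex_signD1 setU11.
rewrite linearZ /= boundary_basis /boundary_simplex.
rewrite big_setU1 //= setU1K // scalerDr -!/(simplex_sign _ _).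
have -> : simplex_sign v (v |: s) = simplex_sign v s.
  by rewrite [RHS]sgU ltnn mul1r.
rewrite scalerA simplex_signK scale1r; congr (_ + _).
rewrite scaler_sumr -sumrN; apply: eq_bigr => i si.
have iv : i != v by apply: contraNneq vNs => <-.
have -> : (v |: s) :\ i = v |: s :\ i.
  by apply/setP=> j; rewrite !inE; case: eqVneq => // ->; rewrite (negPf iv).
rewrite !inE (negPf vNs) andbF simplex_signD1 -/(simplex_sign _ _) si.
rewrite (sgU i) !scalerA -scaleNr.
congr (_ *: _); move: iv; rewrite -val_eqE /=.
by case: ltngtP => // _ _; ring.
Qed.

(** An oriented simplex in list order. It vanishes when an entry repeats, so degenerate facets of
    cross-polytopes can stay in all sums. *)
Definition wedge x : chain := foldr (fun v c => cone v c) (ebase set0) x.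

Lemma wedge_uniq x : uniq x ->
  {e : K | e != 0 & wedge x = e *: ebase [set v in x]}.
Proof.
elim: x => [_|v x IHx /= /andP[vx /IHx[e e0 ->]]].
  by exists 1; rewrite ?oner_eq0 // scale1r; congr (ebase _);
    apply/setP=> i; rewrite !inE.
exists (e * simplex_sign v [set w in x]).
  by rewrite mulf_neq0 // signr_eq0.
rewrite linearZ /= cone_basis /cone_simplex inE (negPf vx) scalerA.
by congr (_ *: ebase _); apply/setP=> i; rewrite !inE.
Qed.

Lemma wedge_notuniq x : ~~ uniq x -> wedge x = 0.
Proof.
elim: x => //= v x IHx; rewrite negb_and negbK.
have [/wedge_uniq[e _ ->] | /IHx->] := boolP (uniq x); last by rewrite linear0.
rewrite orbF => vx.
by rewrite linearZ /= cone_basis /cone_simplex inE vx scaler0.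
Qed.

(** * Cross-polytopes and residues of sums *)

Section CrossPolytope.
Variable r : 'I_n -> 'I_n.
Local Notation W x := (wedge (map r x)).
Local Notation Sum x := (\sum_(i <- x) (i : nat))%N.

(** The join of the 0-spheres r(v+1) - r(v), for v in y; expanding the differences yields the signed
    facets. *)
Definition cross_polytope y : chain :=
  foldr (fun v c => cone (r (ordS v)) c - cone (r v) c) (ebase set0) y.

(** In the difference of two cones over the same chain, the leading terms of [boundary_cone] cancel;
    the remaining ones vanish by induction. *)
Lemma boundary_cross_polytope y : bd (cross_polytope y) = 0.
Proof.
elim: y => [|v y IHy] /=.
  by rewrite boundary_basis /boundary_simplex big_set0.
by rewrite linearB /= !boundary_cone IHy !linear0 !addr0 subrr.
Qed.

Lemma Sum_ordS v x : (Sum (ordS v :: x) = Sum (v :: x) + 1 %[mod n])%N.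
Proof. by rewrite !big_cons /= modnDml; congr (_ %% _)%N; lia. Qed.

Lemma Sum_map_ordS y : (Sum (map (@ordS n) y) = Sum y + size y %[mod n])%N.
Proof.
elim: y => [|v y IHy] /=; first by rewrite addn0.
rewrite Sum_ordS !big_cons addnAC -modnDmr IHy modnDmr.
by congr (_ %% _)%N; lia.
Qed.

Variable U : {vspace chain}.

(** The map f is arbitrary so that the induction can absorb the cone over the first vertex into
    it. *)
Lemma cross_polytope_mem y (f : 'End(chain)) :
    (forall z j, size z = size y -> (j <= size y)%N ->
       Sum z = (Sum y + j)%N %[mod n] -> f (W z) \in U) ->
  f (cross_polytope y) \in U.
Proof.
elim: y f => [|v y IHy] f Hf /=; first by apply: (Hf [::] 0%N); rewrite ?addn0.
have step (u : 'I_n) i : (i <= 1)%N -> (u = v + i %[mod n])%N ->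
    f (cone (r u) (cross_polytope y)) \in U.
  move=> i1 uE; rewrite -[f _](comp_lfunE f (cone (r u))).
  apply: IHy => z j sz jy zE; rewrite comp_lfunE.
  apply: (Hf (u :: z) (i + j)%N) => /=; [by rewrite sz|lia|].
  by rewrite !big_cons -modnDm uE zE modnDm; congr (_ %% _)%N; lia.
rewrite linearB /=; apply: memvB.
  by apply: (step _ 1%N); rewrite //= modn_mod addn1.
by apply: (step _ 0%N); rewrite ?addn0.
Qed.

(* The facets of the cross-polytope have label sums [Sum y + j], and the facet
   on [map ordS y] is the only one with [j = size y]. *)
Lemma wedge_ordS_mem y (f : 'End(chain)) :
    (forall z j, size z = size y -> (j < size y)%N ->
       Sum z = (Sum y + j)%N %[mod n] -> f (W z) \in U) ->
  f (cross_polytope y) \in U -> f (W (map (@ordS n) y)) \in U.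
Proof.
elim: y f => [|v y IHy] f Hf //=; rewrite linearB /= => fP.
rewrite -[f _](comp_lfunE f (cone (r (ordS v)))); apply: IHy => [z j sz jy zE|].
  rewrite comp_lfunE; apply: (Hf (ordS v :: z) j.+1) => /=; [by rewrite sz|lia|].
  rewrite Sum_ordS !big_cons addnAC -modnDmr zE modnDmr.
  by congr (_ %% _)%N; lia.
(* The cone over r(v+1) is the difference, handled by [fP], plus the cone over r(v), whose facets
   all have offset at most [size y], below the top one. *)
rewrite comp_lfunE -[f _](subrK (f (cone (r v) (cross_polytope y)))) memvD //.
rewrite -[f _](comp_lfunE f (cone (r v))); apply: cross_polytope_mem.
move=> z j sz jy zE; rewrite comp_lfunE; apply: (Hf (v :: z) j) => /=.
- by rewrite sz.
- by rewrite ltnS.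
- by rewrite !big_cons -modnDmr zE modnDmr addnA.
Qed.

(** Each x is the top facet of the cross-polytope on its tuple of predecessors. As that chain is a
    cycle, the boundary of the top facet is controlled by those of the facets with the d preceding
    residues. *)
Lemma boundary_wedge_mem (d a : nat) :
    (forall x, size x = d -> ((Sum x + a) %% n < d)%N -> bd (W x) \in U) ->
  forall x, size x = d -> bd (W x) \in U.
Proof.
(* The induction runs on a natural representative m of the residue: for m >= d the other facets have
   representatives m - d + j with j < d, all below m. *)
move=> HU x; have [m] : {m : nat | (Sum x + a = m %[mod n])%N} by eexists.
elim/ltn_ind: m x => m IHm x xE szx.
have [md|dm] := ltnP m d.
  by apply: HU; rewrite ?xE //; apply: leq_ltn_trans (leq_mod _ _) md.
pose y := map (@ord_pred n) x.
have xy : x = map (@ordS n) y by rewrite mapK //; exact: ord_predK.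
have szy : size y = d by rewrite size_map.
have yE : (Sum y + a + d = m %[mod n])%N.
  by rewrite -xE xy addnAC -modnDml -szy -Sum_map_ordS modnDml.
rewrite xy; apply: wedge_ordS_mem; last by rewrite boundary_cross_polytope mem0v.
move=> z j szz jd zE; rewrite szy in szz jd.
apply: (IHm (m - d + j)%N) => //; first by clear -dm jd; lia.
apply/eqP; rewrite -(eqn_modDr d); apply/eqP.
have -> : (m - d + j + d = m + j)%N by clear -dm; lia.
rewrite -[RHS]modnDml -yE modnDml -addnA -modnDml zE modnDml.
by congr (_ %% _)%N; clear; lia.
Qed.
End CrossPolytope.
End Chains.

(** * Betti numbers and face numbers *)

Section Dimension.
Variables (K : fieldType) (n : nat).
Implicit Types (X : {set {set 'I_n}}) (j : int).

Lemma dim_chains X j : \dim (chains K X j) = #|simplices X j|.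
Proof.
rewrite cardE; set S := enum _.
have uS : uniq S := enum_uniq _.
suff : free [seq basis_chain K s | s <- S] by move/eqP; rewrite size_map.
elim: S uS => [_|s S IHS /= /andP[sS /IHS frS]]; first exact: nil_free.
rewrite free_cons frS andbT; apply/negP => sX.
have /ffunP/(_ s) := coord_span (X := in_tuple _) sX.
rewrite sum_ffunE ffunE eqxx big1 => [/eqP|i _]; first by rewrite oner_eq0.
have [t tS ->] : exists2 t, t \in S &
    (in_tuple [seq basis_chain K t | t <- S])`_i = basis_chain K t.
  by apply/mapP; exact: mem_nth.
rewrite !ffunE (_ : s == t = false) ?scaler0 //.
by apply: contraNF sS => /eqP->.
Qed.

Lemma mem_chains_ind X j (f : 'End({ffun {set 'I_n} -> K^o}))
    (U : {vspace {ffun {set 'I_n} -> K^o}}) :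
    (forall s, s \in simplices X j -> f (basis_chain K s) \in U) ->
  forall c, c \in chains K X j -> f c \in U.
Proof.
move=> fU c cX; rewrite memv_preim; apply: subvP cX; apply/span_subvP=> e.
by case/mapP=> s; rewrite mem_enum => /fU fs ->; rewrite -memv_preim.
Qed.

(** Rank-nullity in degrees j and j + 1, with the cycles of degree j - 1 bounded crudely by all
    chains. For j = k - 1 this loses only order n^(k-1). *)
Lemma betti_lower_bound X j : simplicial_complex X ->
  (#|simplices X j| <=
   reduced_betti K X j + #|simplices X (j - 1)| + #|simplices X (j + 1)|)%N.
Proof.
move=> scX.
have := limg_ker_dim (boundary K n) (chains K X j).
have := dimvS (boundaries_sub_cycles K (j - 1) scX).
rewrite /boundaries subrK => le1.
have := dimvS (capvSl (chains K X (j - 1)) (lker (boundary K n))).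
have := dimvS (boundaries_sub_cycles K j scX).
have := limg_ker_dim (boundary K n) (chains K X (j + 1)).
rewrite /reduced_betti /boundaries -/(cycles K X (j - 1)) -!dim_chains.
rewrite -/(cycles K X j).
move: le1; move: (\dim (_ @: chains K X j)) (\dim (cycles K X j)).
move: (\dim (cycles K X (j - 1))).
move: (\dim (_ @: chains K X (j + 1))) (\dim (chains K X _)).
move: (\dim (chains K X _)) (\dim (chains K X _)); lia.
Qed.
End Dimension.

(** * Construction of the complex *)

Section Complex.
Variables (n k l : nat) (w0 : 'I_n).
Implicit Types (s t T : {set 'I_n}) (v w : 'I_n) (x : seq 'I_n).

(** The default [w0] is returned only if t contains every vertex. *)
Definition apex t : 'I_n := odflt w0 [pick w | w \notin t].

Lemma apexP t : (#|t| < n)%N -> apex t \notin t.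
Proof.
move=> tn; rewrite /apex; case: pickP => //= tT.
have : #|t| = #|'I_n| by apply: eq_card => i; move: (tT i) => /negbFE.
by rewrite card_ord => tE; rewrite tE ltnn in tn.
Qed.

Definition label_sum (s : {set 'I_n}) : nat := (\sum_(i in s) i)%N.

Lemma label_sumU s t :
  [disjoint s & t] -> label_sum (s :|: t) = (label_sum s + label_sum t)%N.
Proof.
by move=> st; rewrite /label_sum -bigU //; apply: eq_bigl => i; rewrite !inE.
Qed.

Definition sum_facets : {set {set 'I_n}} :=
  [set s : {set 'I_n} | (#|s| == k.+1) && (label_sum s %% n < k - l)%N].

(* If the retraction of a tuple x moves its entry v in t to [apex t], then the
   vertices of t and the other entries of x form a set T for which
   [label_sum T + v] is the sum of x plus that of t: v counts twice. *)
Definition repair_bases : {set {set 'I_n}} :=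
  [set T : {set 'I_n} |
    (#|T| == k) && [exists v in T, (label_sum T + v) %% n < k - l]%N].

(** Here [p.1] stands for t and [p.2] for T. Allowing every subset t of T costs only a factor 2^k in
    the count; if [apex p.1] lies in T, the result is a k-set, already in the skeleton. *)
Definition repair_facets : {set {set 'I_n}} :=
  [set apex p.1 |: p.2 |
    p : {set 'I_n} * {set 'I_n} in
    [set p : {set 'I_n} * {set 'I_n} |
      (p.2 \in repair_bases) && (p.1 \subset p.2)]].

Definition complex : {set {set 'I_n}} :=
  [set s : {set 'I_n} | (#|s| <= k)%N] :|: sum_facets :|: repair_facets.

Lemma card_complex s : s \in complex -> (#|s| <= k.+1)%N.
Proof.
rewrite !inE => /orP[/orP[/leqW//|/andP[/eqP-> _]//]|].
case/imsetP=> p; rewrite !inE => /andP[/andP[/eqP Tk _] _] ->.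
by rewrite cardsU1 Tk; case: (_ \notin _).
Qed.

Lemma small_in_complex s : (#|s| <= k)%N -> s \in complex.
Proof. by rewrite !inE => ->. Qed.

(** Proper faces have at most k vertices and lie in the full skeleton, whichever (k+1)-sets are
    added. *)
Lemma complex_simplicial : simplicial_complex complex.
Proof.
split=> [|s t Xs]; first by rewrite small_in_complex ?cards0.
rewrite subEproper => /orP[/eqP->//|/proper_card ts].
by apply/small_in_complex; rewrite -ltnS (leq_trans ts) ?card_complex.
Qed.

Lemma skeleton_sub_complex :
  skeleton (full_simplex n) (k%:Z - 1) \subset complex.
Proof.
apply/subsetP=> s; rewrite inE => /andP[_]; rewrite /dim_simplex => sk.
by apply: small_in_complex; lia.
Qed.

Lemma complex_sub_skeleton : complex \subset skeleton (full_simplex n) k%:Z.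
Proof.
apply/subsetP=> s /card_complex sk; rewrite !inE /dim_simplex; lia.
Qed.

(** * Acyclicity of the links *)

Section Link.
Variables (K : fieldType) (t : {set 'I_n}).
Hypotheses (lt_lk : (l < k)%N) (lt_kn : (k < n)%N) (card_t : #|t| = l.+1).
Local Notation ebase := (@basis_chain K n).
Local Notation bd := (@boundary K n).

Let r v := if v \in t then apex t else v.

Let apex_t : apex t \notin t.
Proof. by apply: apexP; rewrite card_t; apply: leq_ltn_trans lt_kn. Qed.

Let r_notin v : r v \notin t.
Proof. by rewrite /r; case: ifP => // ->. Qed.

Lemma label_sum_seq x : uniq x -> label_sum [set v in x] = (\sum_(i <- x) i)%N.
Proof.
by move=> ux; rewrite big_uniq //; apply: eq_bigl => i; rewrite inE.
Qed.

(** As [map r x] has no repetition, at most one entry of x lies in t. If none does, r fixes x and a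
    sum facet results; if v does, the result is a repair facet whose base consists of t and the
    other entries of x. *)
Lemma retract_facet x : size x = (k - l)%N -> uniq (map r x) ->
    ((\sum_(i <- x) i + label_sum t) %% n < k - l)%N ->
  t :|: [set v in map r x] \in complex.
Proof.
move=> szx ux; have x_uniq := map_uniq ux.
have tI : [disjoint t & [set v in map r x]].
  rewrite disjoint_subset; apply/subsetP=> v tv; rewrite !inE.
  apply/negP=> /mapP[u _ vE].
  by move: tv; rewrite vE (negPf (r_notin u)).
have tC : #|t :|: [set v in map r x]| = k.+1.
  rewrite cardsU disjoint_setI0 // cards0 subn0 card_t.
  rewrite cardsE (card_uniqP ux) size_map szx; lia.
have [/hasP[v xv /= tv] sum_d|xNt sum_d] := boolP (has (fun v => v \in t) x).
  have r_rem : {in rem v x, forall u, r u = u}.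
    move=> u xu; rewrite /r ifN //; apply/negP => tu.
    move: ux; rewrite (perm_uniq (perm_map r (perm_to_rem xv))) /=.
    by case/andP=> + _; rewrite {1}/r tv => /mapP[]; exists u => //; rewrite /r tu.
  have r_rem_map : map r (rem v x) = rem v x.
    by rewrite -[RHS]map_id; apply/eq_in_map.
  move: ux; rewrite (perm_uniq (perm_map r (perm_to_rem xv))) /= r_rem_map.
  case/andP; rewrite {1}/r tv => apexN urem.
  have setE : [set u in map r x] = apex t |: [set u in rem v x].
    apply/setP=> u; rewrite !inE (perm_mem (perm_map r (perm_to_rem xv))) /=.
    by rewrite r_rem_map inE {1}/r tv.
  apply/setUP; right; apply/imsetP.
  exists (t, t :|: [set u in rem v x]) => /=; last by rewrite setE setUCA.
  have NT : apex t \notin t :|: [set u in rem v x] by rewrite !inE negb_or apex_t.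
  rewrite !inE subsetUl andbT /=; apply/andP; split.
    by rewrite -eqSS -tC setE setUCA cardsU1 NT.
  apply/existsP; exists v; rewrite inE tv /=; apply: leq_ltn_trans sum_d.
  rewrite leq_eqVlt; apply/orP; left; apply/eqP; congr (_ %% _)%N.
  have tI' : [disjoint t & [set u in rem v x]].
    by apply: disjointWr tI; rewrite setE subsetUr.
  rewrite label_sumU // label_sum_seq ?rem_uniq // [RHS]addnC.
  by rewrite (perm_big _ (perm_to_rem xv)) big_cons /=; lia.
have rx : map r x = x.
  rewrite -[RHS]map_id; apply/eq_in_map => u xu; rewrite /r ifN //.
  by apply: contra xNt => tu; apply/hasP; exists u.
rewrite rx in tC tI *; rewrite !inE tC eqxx /=; apply/orP; left; apply/orP; right.
by rewrite label_sumU // label_sum_seq // addnC.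
Qed.

(** A cycle is the boundary of its cone over [apex t]. That cone may leave the link, but its terms
    are wedges of k - l vertices outside t, whose boundaries lie in B by [boundary_wedge_mem]. *)
Lemma link_acyclic : reduced_betti K (link complex t) (k%:Z - l%:Z - 2) = 0%N.
Proof.
apply/eqP; rewrite subn_eq0; apply: dimvS; apply/subvP=> c.
set B := boundaries _ _ _; rewrite memv_cap memv_ker => /andP[cL /eqP dc].
have wedgeB x : size x = (k - l)%N -> bd (wedge K (map r x)) \in B.
  apply: (@boundary_wedge_mem _ _ r B _ (label_sum t)) => {}x szx sum_d.
  have [ux|] := boolP (uniq (map r x)); last first.
    by move/wedge_notuniq=> ->; rewrite linear0 mem0v.
  have [e _ ->] := wedge_uniq K ux; rewrite linearZ memvZ //= memv_img //.
  apply/memv_span/map_f; rewrite mem_enum.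
  have cx : #|[set v in map r x]| = (k - l)%N.
    by rewrite cardsE (card_uniqP ux) size_map.
  apply/setIdP; split; last by rewrite /dim_simplex cx; lia.
  apply/setIdP; split; first by rewrite small_in_complex // cx leq_subr.
  rewrite setUC retract_facet //=; apply/eqP/setP=> v; rewrite !inE.
  by apply/negP=> /andP[/mapP[u _ ->]]; rewrite (negPf (r_notin u)).
have -> : c = bd (cone K (apex t) c) by rewrite boundary_cone dc linear0 subr0.
rewrite -comp_lfunE; apply: mem_chains_ind cL => s.
rewrite comp_lfunE => /setIdP[/setIdP[_ /andP[_ st]]]; rewrite /dim_simplex => sd.
(* Since s avoids t, r fixes all these entries. *)
have xE : wedge K (apex t :: enum s) = wedge K (map r (apex t :: enum s)).
  congr (wedge _ _) => /=; rewrite {1}/r (negPf apex_t); congr cons.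
  rewrite -[LHS]map_id; apply/eq_in_map => v; rewrite mem_enum => sv.
  rewrite /r ifN //.
  by apply: contraTN st => tv; apply/set0Pn; exists v; rewrite inE sv.
have [e e0 sE] := wedge_uniq K (enum_uniq s).
have -> : ebase s = e^-1 *: wedge K (enum s).
  rewrite sE scalerA mulVf // scale1r; congr (ebase _).
  by apply/setP=> v; rewrite inE mem_enum.
rewrite !linearZ memvZ //= -[cone _ _ _]/(wedge K (apex t :: enum s)) xE wedgeB //=.
have -> : size (enum s) = #|s| by rewrite cardE.
by clear -sd lt_lk; lia.
Qed.
End Link.
End Complex.

(** * Counting the facets *)

Lemma card_dep_pairs (S T : finType) (P : pred S) (Q : S -> pred T) :
  #|[set p : S * T | P p.1 && Q p.1 p.2]| =
  (\sum_(s | P s) #|[set t | Q s t]|)%N.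
Proof.
rewrite -sum1_card (eq_bigl (fun p : S * T => P p.1 && Q p.1 p.2)); last first.
  by move=> p; rewrite inE.
rewrite -(pair_big_dep P Q (fun _ _ => 1%N)) /=; apply: eq_bigr => s _.
by rewrite -sum1_card; apply: eq_bigl => t; rewrite inE.
Qed.

Section Counting.
Variables (n : nat).
Implicit Types (s t T : {set 'I_n}) (v w : 'I_n).

Lemma card_label_pairs (j M : nat) (P : nat -> nat -> bool) :
    (forall b, #|[set v : 'I_n | P b v]| <= M)%N ->
  (#|[set p : {set 'I_n} * 'I_n | (#|p.1| == j) && P (label_sum p.1) p.2]|
     <= 'C(n, j) * M)%N.
Proof.
move=> PM; rewrite (card_dep_pairs (fun s => #|s| == j)
  (fun s (v : 'I_n) => P (label_sum s) v)) -[n in 'C(n, j)]card_ord -card_draws.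
rewrite -sum1dep_card big_distrl /=.
by apply: leq_sum => s _; rewrite mul1n.
Qed.

Lemma label_sumD1 s v : v \in s -> label_sum s = (label_sum (s :\ v) + v)%N.
Proof. by move=> sv; rewrite /label_sum (big_setD1 v) //= addnC. Qed.

Lemma card_residues1 (b d : nat) :
  (#|[set v : 'I_n | (b + v) %% n < d]| <= d)%N.
Proof.
have [n0|n0] := posnP n.
  have -> : [set v : 'I_n | ((b + v) %% n < d)%N] = set0.
    by apply/setP=> v; case: v => v vn; exfalso; rewrite n0 in vn.
  by rewrite cards0.
case: d => [|d]; first by rewrite leqn0 cards_eq0; apply/eqP/setP=> v; rewrite !inE.
rewrite -[leqRHS]card_ord -(card_in_imset (f := fun v : 'I_n =>
   inord ((b + v) %% n) : 'I_d.+1)).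
  exact: max_card.
move=> u v; rewrite !inE => ud vd /(congr1 val); rewrite /= !inordK // => /eqP.
by rewrite eqn_modDl !modn_small // => /eqP/val_inj.
Qed.

(** Doubling modulo n is at most two-to-one, and two preimages are told apart by whether
    [2 * v < n]. *)
Lemma card_residues2 (b d : nat) :
  (#|[set v : 'I_n | (b + 2 * v) %% n < d]| <= 2 * d)%N.
Proof.
case: d => [|d]; first by rewrite leqn0 cards_eq0; apply/eqP/setP=> v; rewrite !inE.
have -> : (2 * d.+1 = #|{: bool * 'I_d.+1}|)%N by rewrite card_prod card_bool card_ord.
rewrite -(card_in_imset (f := fun v : 'I_n =>
   ((2 * v < n)%N, inord ((b + 2 * v) %% n) : 'I_d.+1))).
  exact: max_card.
move=> u v; rewrite !inE => ud vd [] side /(congr1 val); rewrite /= !inordK // => /eqP.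
rewrite eqn_modDl => /eqP uv; apply: val_inj => /=.
have := ltn_ord u; have := ltn_ord v => vn un.
move: side; case: (ltnP (2 * v) n) => vh side.
  by move: uv; rewrite !modn_small //; lia.
move: uv; have uh : (n <= 2 * u)%N by lia.
rewrite -(subnK vh) -(subnK uh).
by rewrite !modnDr !modn_small; lia.
Qed.

Variables (k l : nat) (w0 : 'I_n).

(** Double counting of pairs of a facet s and a vertex v of s: each k-set [s :\ v] leaves at most k
    - l choices for v. *)
Lemma card_sum_facets :
  (k.+1 * #|sum_facets n k l| <= 'C(n, k) * (k - l))%N.
Proof.
apply: leq_trans _ (card_label_pairs k
  (P := fun b m => (b + m) %% n < k - l)%N
  (fun b => card_residues1 b (k - l))).
set Q := [set p | _].
have -> : (k.+1 * #|sum_facets n k l| =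
           #|[set p : {set 'I_n} * 'I_n |
               (p.1 \in sum_facets n k l) && (p.2 \in p.1)]|)%N.
  rewrite (card_dep_pairs (mem (sum_facets n k l)) (fun s v => v \in s)).
  rewrite mulnC -sum_nat_const; apply: eq_bigr => s.
  by rewrite inE => /andP[/eqP <- _]; apply: eq_card => v; rewrite inE.
rewrite -(card_in_imset (f := fun p : {set 'I_n} * 'I_n => (p.1 :\ p.2, p.2))).
  apply/subset_leq_card/subsetP=> _ /imsetP[[s v] + ->].
  rewrite !inE /= => /andP[/andP[sk sd] sv].
  by rewrite -label_sumD1 // sd andbT -eqSS -(eqP sk) (cardsD1 v s) sv.
move=> [s u] [t v]; rewrite !inE /= => /andP[_ su] /andP[_ tv] [] stE uv.
by rewrite -(setD1K su) stE -uv setD1K // uv.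
Qed.

(** Splitting off the vertex v that counts twice leaves a (k-1)-set, which allows at most 2(k - l)
    values of v. *)
Lemma card_repair_bases : (0 < k)%N ->
  (#|repair_bases n k l| <= 'C(n, k.-1) * (2 * (k - l)))%N.
Proof.
move=> k0; apply: leq_trans _ (card_label_pairs k.-1
  (P := fun b m => (b + 2 * m) %% n < k - l)%N
  (fun b => card_residues2 b (k - l))).
set Q := [set p | _].
apply: leq_trans _ (leq_imset_card (fun p : {set 'I_n} * 'I_n => p.2 |: p.1) Q).
apply/subset_leq_card/subsetP=> s; rewrite inE => /andP[/eqP sk /existsP[v]].
case/andP=> sv sd; apply/imsetP; exists (s :\ v, v) => /=; last by rewrite setD1K.
rewrite inE /=; apply/andP; split.
  by move: sk; rewrite (cardsD1 v s) sv => <-.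
by move: sd; rewrite (label_sumD1 sv) -addnA addnn mul2n.
Qed.

Lemma card_repair_facets : (0 < k)%N ->
  (#|repair_facets k l w0| <= 'C(n, k.-1) * (2 * (k - l)) * 2 ^ k)%N.
Proof.
move=> k0; apply: leq_trans (leq_imset_card _ _) _.
apply: leq_trans _ (leq_mul (card_repair_bases k0) (leqnn _)).
(* The coordinates are swapped so that the count runs over T first, with 2^k subsets t for each. *)
rewrite -(card_imset _ (f := fun p : {set 'I_n} * {set 'I_n} => (p.2, p.1)));
  last first.
  by move=> [? ?] [? ?] [-> ->].
apply: leq_trans (_ : _ <= #|[set p : {set 'I_n} * {set 'I_n} |
    (p.1 \in repair_bases n k l) && (p.2 \subset p.1)]|)%N _.
  by apply/subset_leq_card/subsetP=> _ /imsetP[p + ->]; rewrite !inE.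
rewrite (card_dep_pairs (mem (repair_bases n k l)) (fun s t => t \subset s)).
rewrite -sum_nat_const leq_sum // => s /setIdP[/eqP <- _].
by rewrite -card_powerset.
Qed.

(** The (k-1)-skeleton is full, so two of the face numbers in [betti_lower_bound] are binomial
    coefficients. *)
Lemma complex_betti (K : fieldType) : (0 < k)%N ->
  ('C(n, k) <= reduced_betti K (complex k l w0) (k%:Z - 1) + 'C(n, k.-1) +
     (#|sum_facets n k l| + 'C(n, k.-1) * (2 * (k - l)) * 2 ^ k))%N.
Proof.
move=> k0; have := betti_lower_bound K (k%:Z - 1) (complex_simplicial k l w0).
have draws j : #|[set s : {set 'I_n} | #|s| == j]| = 'C(n, j).
  by rewrite card_draws card_ord.
have -> : simplices (complex k l w0) (k%:Z - 1) = [set s : {set 'I_n} | #|s| == k].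
  apply/setP=> s; rewrite [RHS]in_set.
  apply/setIdP/idP; rewrite /dim_simplex; [case=> _; lia|move=> sk].
  by rewrite small_in_complex (eqP sk).
have -> : simplices (complex k l w0) (k%:Z - 1 - 1) =
    [set s : {set 'I_n} | #|s| == k.-1].
  apply/setP=> s; rewrite [RHS]in_set.
  apply/setIdP/idP; rewrite /dim_simplex; [case=> _; lia|move=> sk].
  by rewrite small_in_complex (eqP sk) ?leq_pred //; split=> //; lia.
rewrite !draws subrK => /leq_trans; apply; rewrite leq_add2l.
apply: leq_trans _ (leq_add (leqnn _) (card_repair_facets k0)).
apply: leq_trans (leq_card_setU _ _); apply/subset_leq_card/subsetP=> s.
rewrite inE /dim_simplex => /andP[/setUP[/setUP[|sF]|sF]].
- by rewrite inE; lia.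
- by rewrite in_setU sF.
- by rewrite in_setU sF orbT.
Qed.
End Counting.

(** * Binomial estimates *)

Lemma bin_mul_bin (n k l : nat) : (l <= k)%N -> (k <= n)%N ->
  ('C(n, l) * 'C(n - l, k - l) = 'C(n, k) * 'C(k, l))%N.
Proof.
move=> lk kn.
have fact_neq0 : (0 < l`! * (k - l)`! * (n - k)`! )%N by rewrite !muln_gt0 !fact_gt0.
apply/eqP; rewrite -(eqn_pmul2r fact_neq0); apply/eqP.
have ln := leq_trans lk kn.
have := bin_fact ln; have := bin_fact kn; have := bin_fact lk.
have : (k - l <= n - l)%N by lia.
move/bin_fact; have -> : (n - l - (k - l) = n - k)%N by lia.
move=> nlE klE nkE nE.
transitivity n`!; first by rewrite -nE -nlE; ring.
by rewrite -nkE -klE; ring.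
Qed.

(** After division, [betti_bound] is at most (l+1)/(k+1) of ['C(n, k)], the share that remains once
    the sum facets have taken at most (k-l)/(k+1). *)
Lemma bound_le_bin (n k l : nat) : (l < k)%N -> (k < n)%N ->
  (k.+1 * ('C(n - 1, l) * 'C(n - l - 2, k - l)) <=
   l.+1 * ('C(k.+1, l.+1) * 'C(n, k)))%N.
Proof.
move=> lk kn; have -> : (n - l - 2 = (n - 1 - l).-1)%N by lia.
apply: (@leq_trans (k.+1 * ('C(n - 1, k) * 'C(k, l)))).
  rewrite -bin_mul_bin ?(ltnW lk) //; last by lia.
  by rewrite !leq_mul // leq_bin2l // leq_pred.
rewrite mulnCA mul_bin_diag mulnCA leq_mul // mulnC leq_mul //.
by rewrite leq_bin2l // leq_subr.
Qed.

Lemma exp_le_ffact (m j : nat) : (j <= m)%N -> ((m - j).+1 ^ j <= m ^_ j)%N.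
Proof.
elim: j m => [|j IHj] [|m] //; rewrite ltnS => jm.
by rewrite expnS ffactnS leq_mul ?IHj // subSS ltnS leq_subr.
Qed.

(** Each of the j factors of [m ^_ j] is at least n/2. *)
Lemma exp_le_bin (n m j : nat) :
  (n <= 2 * (m - j).+1)%N -> (j <= m)%N -> (n ^ j <= 2 ^ j * j`! * 'C(m, j))%N.
Proof.
move=> nm jm; rewrite -mulnA [(j`! * _)%N]mulnC bin_ffact.
apply: (@leq_trans ((2 * (m - j).+1) ^ j)).
  by case: j nm {jm} => // j nm; rewrite leq_exp2r.
by rewrite expnMn leq_mul // exp_le_ffact.
Qed.

Lemma bin_le_exp (n j : nat) : ('C(n, j) <= n ^ j)%N.
Proof.
apply: (@leq_trans (n ^_ j)).
  by rewrite -bin_ffact leq_pmulr // fact_gt0.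
elim: j n => // j IHj [|n] //; rewrite expnS ffactnS leq_mul //=.
by apply: leq_trans (IHj n) _; case: j {IHj} => // j; rewrite leq_exp2r.
Qed.

(** Comparing both sides with n^k shows that the error ['C(n, k.-1)] is O(1/n) times the main term.
    The threshold on n is what [exp_le_bin] requires for the second binomial. *)
Lemma exp_le_bound (n k l : nat) : (l < k)%N -> (2 * k.+1 <= n)%N ->
  (n * 'C(n, k.-1) <=
   2 ^ k * l`! * (k - l)`! * ('C(n - 1, l) * 'C(n - l - 2, k - l)))%N.
Proof.
move=> lk kn; apply: (@leq_trans (n ^ k)).
  by rewrite -[k in leqRHS](ltn_predK lk) expnS leq_mul // bin_le_exp.
rewrite -[k in (n ^ k)%N](subnKC (ltnW lk)) expnD.
have -> : (2 ^ k = 2 ^ l * 2 ^ (k - l))%N by rewrite -expnD subnKC // ltnW.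
have le1 : (n ^ l <= 2 ^ l * l`! * 'C(n - 1, l))%N by apply: exp_le_bin; lia.
have le2 : (n ^ (k - l) <=
    2 ^ (k - l) * (k - l)`! * 'C(n - l - 2, k - l))%N by apply: exp_le_bin; lia.
apply: leq_trans (leq_mul le1 le2) _; rewrite leq_eqVlt; apply/orP; left.
by apply/eqP; ring.
Qed.

Theorem theorem5 (K : fieldType) (R : realFieldType) (k l : nat)
    (lt_l_k : (l < k)%N) :
  exists C : R, forall n : nat, prime n -> (k < n)%N ->
  exists X : {set {set 'I_n}},
    [/\ simplicial_complex X,
        skeleton (full_simplex n) (k%:Z - 1) \subset X,
        X \subset skeleton (full_simplex n) k%:Z,
        lambda K X l%:Z (k%:Z - l%:Z - 2) = 0%N
      & (1 - C / n%:R) * betti_bound R n k l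
          <= (reduced_betti K X (k%:Z - 1))%:R].
Proof.
(* The number of copies of ['C(n, k.-1)] lost: one to the faces of dimension k - 2, the others to
   the repair facets. *)
pose c := (1 + 2 * (k - l) * 2 ^ k)%N.
pose D := (2 ^ k * l`! * (k - l)`!)%N.
pose Q := 'C(k.+1, l.+1).
(* The first summand covers small n. In the second, D comes from [exp_le_bound] and Q clears the
   denominator of [betti_bound]. *)
exists (2 * k.+1 + c * D * Q)%N%:R => n _ lt_kn.
have n_gt0 : (0 < n)%N by apply: leq_ltn_trans lt_kn.
pose w0 := Ordinal n_gt0; exists (complex k l w0); split.
- exact: complex_simplicial.
- exact: skeleton_sub_complex.
- exact: complex_sub_skeleton.
- apply: big1 => t /setIdP[_]; rewrite /dim_simplex => tl.
  by rewrite link_acyclic //; lia.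
have k_gt0 : (0 < k)%N by apply: leq_ltn_trans lt_l_k.
have := complex_betti l w0 K k_gt0.
have := card_sum_facets n k l.
have := bound_le_bin lt_l_k lt_kn.
have := @exp_le_bound n k l lt_l_k.
rewrite /betti_bound !addn1 -/D -/Q.
set P := ('C(n - 1, l) * _)%N; set M := 'C(n, k.-1); set N := 'C(n, k).
set b := reduced_betti _ _ _; set F := #|_|.
move=> MP PN FN Nb; have Q0 : (0 < Q)%N by rewrite /Q bin_gt0 ltnW.
have n0R : 0 < n%:R :> R by rewrite ltr0n.
have Q0R : 0 < Q%:R :> R by rewrite ltr0n.
(* For n < 2(k+1) the constant exceeds n, so the claimed lower bound is not positive. *)
have [nk|kn] := ltnP n (2 * k.+1).
  apply: (@le_trans _ _ 0) => //; apply: mulr_le0_ge0; last by rewrite divr_ge0.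
  by rewrite subr_le0 ler_pdivlMr // mul1r ler_nat ltnW // ltn_addr.
have {PN FN Nb} main : (k.+1 * P <= k.+1 * Q * (b + c * M))%N.
  apply: leq_trans PN _.
  have : (k.+1 * N <= k.+1 * (b + c * M) + N * (k - l))%N.
    apply: leq_trans (leq_mul (leqnn k.+1) Nb) _.
    have -> : (b + M + (F + M * (2 * (k - l)) * 2 ^ k) = b + c * M + F)%N.
      by rewrite /c; ring.
    by rewrite [leqLHS]mulnDr leq_add2l.
  move=> NcM; rewrite mulnCA (mulnC k.+1) -mulnA leq_mul //.
  have : (l.+1 * N + N * (k - l) = k.+1 * N)%N.
    by rewrite [(N * _)%N]mulnC -mulnDl; congr (_ * _)%N; lia.
  lia.
move: main; rewrite -(mulnA _ Q) leq_pmul2l // => {}main.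
have {MP} nMP : n%:R * M%:R <= D%:R * P%:R :> R by rewrite -!natrM ler_nat MP.
have PQ : P%:R / Q%:R <= b%:R + c%:R * M%:R :> R.
  by rewrite ler_pdivrMr // -natrM -natrD -natrM ler_nat mulnC.
have P0 : 0 <= P%:R / Q%:R :> R by rewrite divr_ge0.
have cM : c%:R * M%:R <= (c * D * Q)%:R / n%:R * (P%:R / Q%:R) :> R.
  rewrite (natrM _ _ Q) (natrM _ c).
  have -> : c%:R * D%:R * Q%:R / n%:R * (P%:R / Q%:R)
          = c%:R * (D%:R * P%:R / n%:R) :> R by field; rewrite !gt_eqF.
  by rewrite ler_wpM2l // ler_pdivlMr // mulrC.
have u0 : 0 <= (2 * k.+1)%:R / n%:R * (P%:R / Q%:R) :> R.
  by rewrite mulr_ge0 // divr_ge0.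
by rewrite natrD mulrBl mul1r (mulrDl _ _ n%:R^-1) mulrDl; lra.
Qed.
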